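(* Let $\nu>0$, $\lambda>0$, $\mu>0$, $\eta\in\mathbb{R}\setminus\{0\}$, $\sigma=\lambda+\nu\mu$ with $\sigma\ne0$, and let $m=2p+1$ with $p\in\mathbb{N}_0$. Let $F(V,t)=\nu V$ ($V\in\mathbb{R}$, $t>0$), $h(x)=\eta x^m$ and $\Phi(x)=-\mu\sinh(\lambda x)$. Then the function $$u(x,t)=u_0(x,t)-\nu\Phi(x)\exp(\lambda^2t)\int_0^tV(\tau)\exp(-\lambda^2\tau)\,d\tau,\qquad x\ge 0,\ t\ge 0,$$ is a solution to Problem P, where $$u_0(x,t)=\frac{\eta}{\sqrt{\pi}}\sum_{k=0}^{p}\binom{m}{2k}\Gamma\!\left(\frac{2k+1}{2}\right)(4t)^kx^{m-2k},\qquad x\ge0,\ t\ge0,$$ and $V(t)=u_x(0,t)$ is given by $V(t)=p_{2,m}(t)+c_{2,m}\exp(\lambda\sigma t)$, $t>0$, with $c_{2,m}$ and $p_{2,m}$ as defined in the context.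
   Context: Problem P: $u_t(x,t)-u_{xx}(x,t)=-\Phi(x)F(u_x(0,t),t)$ for $x>0,t>0$; $u(x,0)=h(x)$ for $x>0$; $u(0,t)=0$ for $t>0$. With $m=2p+1$, put $c=\frac{2^{m-1}m\eta}{\sqrt\pi}\Gamma\left(\frac m2\right)$ ($\Gamma$ the Gamma function), $c_{2,m}=\dfrac{c\,\nu\mu\,p!}{\sigma(\lambda\sigma)^p}$, and $$p_{2,m}(t)=\begin{cases}\frac{\eta\lambda}{\sigma} & \text{if }m=1,\\ c_{2,3}\big(\frac{\lambda^2\sigma}{\nu\mu}t-1\big) & \text{if }m=3,\\ c_{2,5}\big(\frac{\lambda^3\sigma^2}{2\nu\mu}t^2-\lambda\sigma t-1\big) & \text{if }m=5,\\ \frac{c\lambda}{\sigma}t^p-c_{2,m}\Big(\sum_{k=1}^{p-1}\frac{(\lambda\sigma)^k}{k!}t^k+1\Big) & \text{if }m\ge 7.\end{cases}$$ *)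

(* Defs.v *)
From HB Require Import structures.
From mathcomp Require Import all_boot all_order all_algebra.
From mathcomp Require Import all_classical all_reals all_analysis.
Import Order.TTheory GRing.Theory Num.Theory.
Import numFieldNormedType.Exports.

Set Implicit Arguments.
Unset Strict Implicit.
Unset Printing Implicit Defensive.

Local Open Scope classical_set_scope.
Local Open Scope ring_scope.

Definition sinh {R : realType} (x : R) : R := (expR x - expR (- x)) / 2.

(* Euler's integral; meaningful for 0 < s, the only arguments used below. *)
Definition Gamma {R : realType} (s : R) : R :=
  \int[lebesgue_measure]_(t in `]0, +oo[) (t `^ (s - 1) * expR (- t)).

Definition rquotient {R : realType} (f : R -> R) (a h : R) : R :=
  (f (a + h) - f a) / h.

Definition rderivable {R : realType} (f : R -> R) (a : R) : Prop :=
  cvg (rquotient f a h @[h --> 0^'+]).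

(* Right derivative; arbitrary unless [rderivable f a]. *)
Definition rderive {R : realType} (f : R -> R) (a : R) : R :=
  lim (rquotient f a h @[h --> 0^'+]).

Definition pderiv_x {R : realType} (u : R -> R -> R) (x t : R) : R :=
  derive1 (fun y => u y t) x.

Definition pderiv_xx {R : realType} (u : R -> R -> R) (x t : R) : R :=
  pderiv_x (pderiv_x u) x t.

Definition pderiv_t {R : realType} (u : R -> R -> R) (x t : R) : R :=
  derive1 (fun s => u x s) t.

(* u_x(0, t): one-sided, since the spatial domain is [0, +oo). *)
Definition pderiv_x0 {R : realType} (u : R -> R -> R) (t : R) : R :=
  rderive (fun y => u y t) 0.

Definition open_quadrant {R : realType} : set (R * R) :=
  [set z | 0 < z.1 /\ 0 < z.2].

Definition closed_quadrant {R : realType} : set (R * R) :=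
  [set z | 0 <= z.1 /\ 0 <= z.2].

Definition continuous2_on {R : realType} (D : set (R * R)) (u : R -> R -> R)
  : Prop := {within D, continuous (fun z : R * R => u z.1 z.2)}.

(* Classical solution: C^{2,1} in the open quadrant, continuous up to the
   boundary, and with a flux u_x(0, t) at every t > 0. The values of [u]
   outside the closed quadrant are irrelevant. *)
Record solves_problem_P {R : realType} (Phi : R -> R) (F : R -> R -> R)
    (h : R -> R) (u : R -> R -> R) : Prop := SolvesProblemP {
  sol_continuous : continuous2_on closed_quadrant u;
  sol_derivable_x : forall x t : R, 0 < x -> 0 < t ->
    derivable (fun y => u y t) x 1;
  sol_derivable_xx : forall x t : R, 0 < x -> 0 < t ->
    derivable (fun y => pderiv_x u y t) x 1;
  sol_derivable_t : forall x t : R, 0 < x -> 0 < t ->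
    derivable (fun s => u x s) t 1;
  sol_continuous_x : continuous2_on open_quadrant (pderiv_x u);
  sol_continuous_xx : continuous2_on open_quadrant (pderiv_xx u);
  sol_continuous_t : continuous2_on open_quadrant (pderiv_t u);
  sol_flux : forall t : R, 0 < t -> rderivable (fun y => u y t) 0;
  sol_equation : forall x t : R, 0 < x -> 0 < t ->
    pderiv_t u x t - pderiv_xx u x t = - Phi x * F (pderiv_x0 u t) t;
  sol_initial : forall x : R, 0 < x -> u x 0 = h x;
  sol_boundary : forall t : R, 0 < t -> u 0 t = 0
}.

Definition coef_c {R : realType} (eta : R) (m : nat) : R :=
  2 ^+ m.-1 * m%:R * eta / Num.sqrt pi * Gamma (m%:R / 2).

(* In [coef_c2] and [p2], [m] is [2 * p + 1] and [sigma] is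
   [lambda + nu * mu]. *)
Definition coef_c2 {R : realType} (nu lambda mu eta sigma : R) (p m : nat)
  : R :=
  coef_c eta m * nu * mu * (p`!)%:R / (sigma * (lambda * sigma) ^+ p).

Definition p2 {R : realType} (nu lambda mu eta sigma : R) (p m : nat) (t : R)
  : R :=
  let c := coef_c eta m in
  let c2 := coef_c2 nu lambda mu eta sigma p m in
  if m == 1%N then eta * lambda / sigma
  else if m == 3%N then c2 * (lambda ^+ 2 * sigma / (nu * mu) * t - 1)
  else if m == 5%N then
    c2 * (lambda ^+ 3 * sigma ^+ 2 / (2 * nu * mu) * t ^+ 2
          - lambda * sigma * t - 1)
  else
    c * lambda / sigma * t ^+ p
    - c2 * (\sum_(1 <= k < p) (lambda * sigma) ^+ k / (k`!)%:R * t ^+ k + 1).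

Definition u0 {R : realType} (eta : R) (p m : nat) (x t : R) : R :=
  eta / Num.sqrt pi *
  \sum_(0 <= k < p.+1)
    'C(m, 2 * k)%:R * Gamma ((2 * k + 1)%:R / 2) * (4 * t) ^+ k
    * x ^+ (m - 2 * k).

(* Main.v *)
(* Put W = c_2 (exp(lambda sigma t) - sum_(k <= p) (lambda sigma t)^k / k!).
   In each of the four cases of the definition of p_2 one has V = c t^p + W,
   and W' = lambda^2 W + lambda nu mu V with W(0) = 0, so the memory integral
   is exp(- lambda^2 t) W(t) / (lambda nu mu).  Hence
   u = u_0 + (sinh(lambda x) / lambda) W(t) is elementary, u_0 is a heat
   polynomial, and u_x(0, t) = c t^p + W(t) = V(t).  The Gamma function enters
   only through Gamma(1/2) = sqrt pi and Gamma(s + 1) = s Gamma(s) at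
   half-integers; both are obtained by carrying along an explicit primitive of
   t^(s-1) e^(-t) on ]0, +oo[, starting from 2 \int_0^(sqrt t) e^(-x^2) dx. *)
Require Import Defs.
From HB Require Import structures.
From mathcomp Require Import all_boot all_order all_algebra.
From mathcomp Require Import all_classical all_reals all_analysis.
From mathcomp Require Import measurable_realfun ring zify.
Import Order.TTheory GRing.Theory Num.Theory.
Import numFieldNormedType.Exports.

Local Open Scope classical_set_scope.
Local Open Scope ring_scope.

(** * Improper integrals of nonnegative functions on an open half-line *)

Lemma itvoy_bigcup_harmonic (R : realType) (a : R) :
  `]a, +oo[%classic = \bigcup_n `[a + n.+1%:R^-1, +oo[%classic.
Proof.
apply/seteqP; split => x /=.
  rewrite in_itv/= andbT => ax.
  have [n _ /(_ n (leqnn n))] : \forall n \near \oo, `|0 - @harmonic R n| < x - a.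
    by move/cvgrPdist_lt: (@cvg_harmonic R); apply; rewrite subr_gt0.
  rewrite sub0r normrN ger0_norm ?harmonic_ge0// => /ltW nxa.
  by exists n => //=; rewrite in_itv/= andbT -lerBrDl.
by move=> [n _] /=; rewrite !in_itv/= !andbT; apply: lt_le_trans; rewrite ltrDl.
Qed.

(** The closed half-lines from [a + 1/(n+1)] exhaust the open one. Nonnegativity gives monotone
    convergence of the integrals over them, and each of these equals [l - F (a + 1/(n+1))]. Nothing
    is asked of [f] at [a], so an integrand singular there, such as t^(-1/2) e^(-t) at 0, is
    covered. *)
Lemma ge0_continuous_FTC2oy (R : realType) (f F : R -> R) (a k l : R) :
  (forall x, a < x -> 0 <= f x) ->
  (forall x, a < x -> {for x, continuous f}) ->
  (forall x, a < x -> is_derive x 1 F (f x)) ->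
  F x @[x --> a^'+] --> k -> F x @[x --> +oo] --> l ->
  (\int[lebesgue_measure]_(x in `]a, +oo[) (f x)%:E = (l - k)%:E)%E.
Proof.
move=> f0 cf dF Fk Fl.
pose A n := `[a + n.+1%:R^-1, +oo[%classic : set (measurableTypeR R).
have aA n x : A n x -> a < x.
  by rewrite /A/= in_itv/= andbT; apply: lt_le_trans; rewrite ltrDl.
have contF x : a < x -> {for x, continuous F}.
  by move=> /dF [/derivable1_diffP /differentiable_continuous].
have cfA n : {within A n, continuous f}.
  by apply: continuous_in_subspaceT => x; rewrite inE => /aA /cf.
have cvgA : (\int[lebesgue_measure]_(x in A n) (f x)%:E)%E @[n --> \oo] -->
    (\int[lebesgue_measure]_(x in `]a, +oo[) (f x)%:E)%E.
  rewrite (itvoy_bigcup_harmonic R a).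
  apply: ge0_nondecreasing_set_cvg_integral.
  - move=> m n mn; apply/subsetPset => x; rewrite /A/= !in_itv/= !andbT.
    by apply: le_trans; rewrite lerD2l lef_pV2 ?posrE// ler_nat.
  - by move=> n; exact: measurable_itv.
  - move=> n; apply/measurable_EFinP.
    apply: subspace_continuous_measurable_fun; first exact: measurable_itv.
    exact: cfA.
  - by move=> n x /aA /f0; rewrite lee_fin.
apply: (cvg_unique _ cvgA) => //.
apply: (@cvg_trans _ ((l%:E - (F (a + n.+1%:R^-1))%:E)%E @[n --> \oo])).
    apply: near_eq_cvg; near=> n; symmetry; rewrite /A.
    apply: ge0_continuous_FTC2y => //.
    + by move=> x ax; apply/f0/aA; rewrite /A/= in_itv/= andbT; exact: ax.
    + exact: cfA.
    + by move=> x ax; case: (dF x) => //; apply: le_lt_trans ax; rewrite lerDl.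
    + by apply/cvg_at_right_filter/contF; rewrite ltrDl.
    + move=> x; rewrite in_itv/= andbT => ax; rewrite derive1E.
      by case: (dF x) => //; apply: lt_trans ax; rewrite ltrDl.
  apply: cvg_EFin; first exact: nearW.
  apply: cvgB; first exact: cvg_cst.
  move/cvg_at_rightP : Fk; apply; split => [n|]; first by rewrite ltrDl.
  by rewrite -[X in _ --> X]addr0; apply: cvgD; [exact: cvg_cst|exact: cvg_harmonic].
Unshelve. all: by end_near. Qed.

(** * The Gamma function at half-integers *)

Lemma is_derive1_continuous (R : realType) (f : R -> R) (x df : R) :
  is_derive x 1 f df -> {for x, continuous f}.
Proof. by move=> [/derivable1_diffP /differentiable_continuous]. Qed.

(** Pick a natural number [N >= s]. Since e^t dominates t^(N+1)/(N+1)!, the product is at most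
    (N+1)!/t as soon as [t >= 1]. *)
Lemma cvg_powR_expRN (R : realType) (s : R) :
  t `^ s * expR (- t) @[t --> +oo] --> (0 : R).
Proof.
pose N := (Num.truncn s).+1.
have sN : s <= N%:R by exact/ltW/truncnS_gt.
apply: (squeeze_cvgr (f := fun=> 0) (h := fun t => (N.+1)`!%:R * t^-1)).
- near=> t.
  have t1 : 1 <= t by near: t; apply: nbhs_pinfty_ge; exact: num_real.
  have t0 : 0 < t by exact: lt_le_trans t1.
  rewrite mulr_ge0 ?powR_ge0 ?expR_ge0//=.
  rewrite expRN ler_pdivrMr ?expR_gt0// mulrAC ler_pdivlMr//.
  apply: (@le_trans _ _ (t ^+ N.+1)).
    by rewrite exprSr ler_wpM2r ?(ltW t0)// -powR_mulrn ?(ltW t0)// ler_powR.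
  rewrite mulrC -ler_pdivrMr ?ltr0n ?fact_gt0//.
  by apply: le_trans (expR_ge1Dxn N (ltW t0)); rewrite lerDr.
- exact: cvg_cst.
- rewrite -[X in _ --> X](mulr0 (N.+1)`!%:R); apply: cvgM; first exact: cvg_cst.
  by apply/gtr0_cvgV0 => //; near=> t; near: t; apply: nbhs_pinfty_gt; exact: num_real.
Unshelve. all: by end_near. Qed.

(** Both end limits belong to the data, so that the functional equation of Gamma reduces to one
    differentiation and two limits. *)
Definition gamma_primitive {R : realType} (s : R) (F : R -> R) (l : R) :=
  [/\ forall t : R, 0 < t -> is_derive t 1 F (t `^ (s - 1) * expR (- t)),
      F t @[t --> 0^'+] --> (0 : R) & F t @[t --> +oo] --> l].

Lemma gamma_primitiveE (R : realType) (s : R) (F : R -> R) (l : R) :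
  gamma_primitive s F l -> Gamma s = l.
Proof.
move=> [dF F0 Fl]; rewrite /Gamma /Rintegral.
rewrite (@ge0_continuous_FTC2oy _ _ F 0 0 l) ?subr0//.
- by move=> t t0; rewrite mulr_ge0 ?powR_ge0 ?expR_ge0.
- move=> t t0; apply: cvgM.
    exact: is_derive1_continuous _ _ _ _ (is_derive1_powR (s - 1) t0).
  apply: (@continuous_comp _ _ _ -%R expR); first exact: continuousN.
  exact: continuous_expR.
Qed.

(** Integration by parts at the level of primitives: differentiating -t^s e^(-t) cancels the
    derivative of [s * F t] and leaves t^s e^(-t). The boundary term vanishes at 0 because [s > 0],
    and at infinity by exponential decay. *)
Lemma gamma_primitiveS (R : realType) (s : R) (F : R -> R) (l : R) : 0 < s ->
  gamma_primitive s F l ->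
  gamma_primitive (s + 1) (fun t => s * F t - t `^ s * expR (- t)) (s * l).
Proof.
move=> s0 [dF F0 Fl]; split.
- move=> t t0; rewrite addrK; have dFt := dF _ t0; have dpt := is_derive1_powR s t0.
  apply: is_derive_eq.
  by rewrite /GRing.scale/=; ring.
- have e0 : expR (- t) @[t --> 0^'+] --> expR (- 0 : R).
    apply: cvg_at_right_filter; apply: (@continuous_comp _ _ _ -%R expR).
      exact: continuousN.
    exact: continuous_expR.
  have := cvgB (cvgM (cvg_cst s) F0) (cvgM (powR_cvg0 s0) e0).
  by rewrite mulr0 mul0r subr0; exact.
- have := cvgB (cvgM (cvg_cst s) Fl) (cvg_powR_expRN _ s).
  by rewrite subr0; exact.
Qed.

(** The substitution t = x^2 turns t^(-1/2) e^(-t) dt into 2 e^(-x^2) dx, so the primitive is twice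
    the Gauss integral up to sqrt t. *)
Lemma gamma_primitive_half (R : realType) :
  gamma_primitive (1 / 2 : R)
    (fun t => 2 * gauss_integral_proof.integral0_gauss (Num.sqrt t))
    (Num.sqrt pi).
Proof.
pose E := @gauss_integral_proof.integral0_gauss R.
have intE (b : R) : lebesgue_measure.-integrable `[0, b] (EFin \o (@gauss_fun R)).
  by apply: integrableS (integrableT_gauss (R := R)); [|exact: measurable_itv|].
split => [t t0||].
- have st0 : 0 < Num.sqrt t by rewrite sqrtr_gt0.
  (* The endpoint [Num.sqrt t + 1] only serves to make [Num.sqrt t] an interior point of the
     interval of integration. *)
  have lt1 : Num.sqrt t < Num.sqrt t + 1 by rewrite ltrDl.
  have [dE E'] := @continuous_FTC1_closed R gauss_fun 0 (Num.sqrt t) (Num.sqrt t + 1)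
    lt1 (intE _) st0 (@continuous_gauss_fun R _).
  have dEt : is_derive (Num.sqrt t) 1 E (gauss_fun (Num.sqrt t)).
    by split => //; rewrite -derive1E.
  have dst := is_derive1_sqrt t0.
  have dEs := is_derive1_comp dEt dst.
  apply: is_derive_eq.
  rewrite /gauss_fun sqr_sqrtr ?(ltW t0)//.
  rewrite (_ : 1 / 2 - 1 = - 2^-1); last by field.
  rewrite powRN powR12_sqrt ?(ltW t0)// /GRing.scale/= invfM.
  by field; rewrite gt_eqF.
- apply: cvg_at_right_filter; rewrite -[X in _ --> X](mulr0 2).
  apply: cvgM; first exact: cvg_cst.
  apply: (@cvg_comp _ _ _ Num.sqrt E _ (nbhs 0)).
    by have := @sqrt_continuous R 0; rewrite /continuous_at sqrtr0.
  exact: parameterized_integral_cvg_left ltr01 (intE _).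
(* The Gauss integral enters through the limit pi / 4 of its square; nonnegativity of [E] then
   allows taking square roots. *)
- have : Num.sqrt (E x ^+ 2) @[x --> +oo] --> Num.sqrt (pi / 4).
    apply: continuous_cvg; first exact: sqrt_continuous.
    exact: gauss_integral_proof.cvg_integral0_gauss_sqr.
  rewrite sqrtrM ?pi_ge0// sqrtrV// (_ : 4 = 2 ^+ 2); last by rewrite expr2 -natrM.
  rewrite sqrtr_sqr ger0_norm// => sE.
  have Ey : E x @[x --> +oo] --> Num.sqrt pi / 2.
    apply: cvg_trans sE; apply: near_eq_cvg; near=> x.
    by rewrite sqrtr_sqr ger0_norm// gauss_integral_proof.integral0_gauss_ge0.
  have -> : Num.sqrt pi = 2 * (Num.sqrt pi / 2) :> R by rewrite mulrC divfK.
  apply: cvgM; first exact: cvg_cst.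
  apply: (@cvg_comp _ _ _ Num.sqrt E _ (pinfty_nbhs R)) => //.
  apply/cvgryPge => A; near=> t.
  have [A0|A0] := leP A 0; first by rewrite (le_trans A0)// sqrtr_ge0.
  rewrite -(ger0_norm (ltW A0)) -sqrtr_sqr; apply: ler_wsqrtr.
  by near: t; apply: nbhs_pinfty_ge; exact: num_real.
Unshelve. all: by end_near. Qed.

Lemma Gamma_half (R : realType) : Gamma (1%:R / 2 : R) = Num.sqrt pi.
Proof. exact: gamma_primitiveE (gamma_primitive_half R). Qed.

(** The limit at infinity is kept as [Gamma] itself instead of an explicit product: beyond
    Gamma(1/2), only the ratio of consecutive values is needed later. *)
Lemma half_gamma_primitive (R : realType) (k : nat) :
  exists F, gamma_primitive ((2 * k + 1)%:R / 2 : R) F (Gamma ((2 * k + 1)%:R / 2)).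
Proof.
elim: k => [|k [F PF]].
  rewrite muln0 add0n Gamma_half.
  by eexists; exact: gamma_primitive_half.
have s0 : 0 < (2 * k + 1)%:R / 2 :> R by rewrite divr_gt0// ltr0n addn1.
have := gamma_primitiveS _ _ _ _ s0 PF.
rewrite (_ : (2 * k.+1 + 1)%:R / 2 = (2 * k + 1)%:R / 2 + 1); last first.
  by rewrite mulnS addnAC natrD; field.
by move=> PS; rewrite (gamma_primitiveE _ _ _ _ PS); eexists; exact: PS.
Qed.

Lemma Gamma_halfS (R : realType) (k : nat) :
  Gamma ((2 * k.+1 + 1)%:R / 2 : R)
  = (2 * k + 1)%:R / 2 * Gamma ((2 * k + 1)%:R / 2).
Proof.
have [F PF] := half_gamma_primitive R k.
have s0 : 0 < (2 * k + 1)%:R / 2 :> R by rewrite divr_gt0// ltr0n addn1.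
rewrite -(gamma_primitiveE _ _ _ _ (gamma_primitiveS _ _ _ _ s0 PF)).
by congr Gamma; rewrite mulnS addnAC natrD; field.
Qed.

(** * From a closed form on the whole plane to a classical solution *)

Lemma is_derive1_rquotient_cvg (R : realType) (f g : R -> R) (a df : R) :
  is_derive a 1 g df -> (forall x : R, a <= x -> f x = g x) ->
  rquotient f a h @[h --> (0:R)^'+] --> df.
Proof.
move=> [dg gE] fg; have : h^-1 *: (g (h *: 1 + a) - g a) @[h --> (0:R)^'] --> df.
  by rewrite -gE; exact: dg.
move=> /cvg_dnbhs_at_right; apply: cvg_trans; apply: near_eq_cvg; near=> h.
have h0 : 0 < h by near: h; exact: nbhs_right_gt.
by rewrite /rquotient !fg ?lerDl ?(ltW h0)// /GRing.scale/= mulr1 (addrC h) mulrC.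
Unshelve. all: by end_near. Qed.

(** [u] is controlled only on the closed quadrant, whereas [U] is regular on the whole plane.
    Derivatives are local, so they transfer at interior points; at [x = 0] the right difference
    quotient sees only [x >= 0]; and continuity within a set depends only on the values on that
    set. *)
Lemma solves_problem_P_closed_form (R : realType) (Phi : R -> R)
  (F : R -> R -> R) (h : R -> R) (u U Ux Uxx Ut : R -> R -> R) :
  (forall x t : R, 0 <= x -> 0 <= t -> u x t = U x t) ->
  (forall x t : R, is_derive x 1 (fun y => U y t) (Ux x t)) ->
  (forall x t : R, is_derive x 1 (fun y => Ux y t) (Uxx x t)) ->
  (forall x t : R, is_derive t 1 (fun s => U x s) (Ut x t)) ->
  continuous (fun z : R * R => U z.1 z.2) ->
  continuous (fun z : R * R => Ux z.1 z.2) ->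
  continuous (fun z : R * R => Uxx z.1 z.2) ->
  continuous (fun z : R * R => Ut z.1 z.2) ->
  (forall x t : R, 0 < x -> 0 < t ->
    Ut x t - Uxx x t = - Phi x * F (Ux 0 t) t) ->
  (forall x : R, 0 < x -> U x 0 = h x) ->
  (forall t : R, 0 < t -> U 0 t = 0) ->
  solves_problem_P Phi F h u /\ (forall t : R, 0 < t -> pderiv_x0 u t = Ux 0 t).
Proof.
move=> uU dU dUx dUt cU cUx cUxx cUt eqn init bnd.
have ux (x t : R) : 0 < x -> 0 < t -> is_derive x 1 (fun y => u y t) (Ux x t).
  move=> x0 t0; apply: near_eq_is_derive (dU x t).
  near=> y; rewrite uU ?(ltW t0)//; apply: ltW.
  by near: y; exact: lt_nbhsr.
have uxE (x t : R) : 0 < x -> 0 < t -> pderiv_x u x t = Ux x t.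
  by move=> x0 t0; rewrite /pderiv_x derive1E; case: (ux x t x0 t0).
have uxx (x t : R) : 0 < x -> 0 < t -> is_derive x 1 (fun y => pderiv_x u y t) (Uxx x t).
  move=> x0 t0; apply: near_eq_is_derive (dUx x t).
  near=> y; rewrite uxE//.
  by near: y; exact: lt_nbhsr.
have uxxE (x t : R) : 0 < x -> 0 < t -> pderiv_xx u x t = Uxx x t.
  by move=> x0 t0; rewrite /pderiv_xx/= {1}/pderiv_x derive1E; case: (uxx x t x0 t0).
have ut (x t : R) : 0 < x -> 0 < t -> is_derive t 1 (fun s => u x s) (Ut x t).
  move=> x0 t0; apply: near_eq_is_derive (dUt x t).
  near=> s; rewrite uU ?(ltW x0)//; apply: ltW.
  by near: s; exact: lt_nbhsr.
have utE (x t : R) : 0 < x -> 0 < t -> pderiv_t u x t = Ut x t.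
  by move=> x0 t0; rewrite /pderiv_t derive1E; case: (ut x t x0 t0).
have flux t : 0 < t -> rquotient (fun y => u y t) 0 h @[h --> (0:R)^'+] --> Ux 0 t.
  move=> t0; apply: is_derive1_rquotient_cvg (dU 0 t) _ => x x0.
  by rewrite uU// ltW.
have fluxE t : 0 < t -> pderiv_x0 u t = Ux 0 t.
  by move=> t0; apply/cvg_lim => //; exact: flux.
split => //; split => //.
- apply: subspace_eq_continuous (continuous_subspaceT cU) => z.
  by rewrite inE => -[z1 z2]; rewrite /from_subspace/= uU.
- by move=> x t x0 t0; case: (ux x t x0 t0).
- by move=> x t x0 t0; case: (uxx x t x0 t0).
- by move=> x t x0 t0; case: (ut x t x0 t0).
- apply: subspace_eq_continuous (continuous_subspaceT cUx) => z.
  by rewrite inE => -[z1 z2]; rewrite /from_subspace/= uxE.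
- apply: subspace_eq_continuous (continuous_subspaceT cUxx) => z.
  by rewrite inE => -[z1 z2]; rewrite /from_subspace/= uxxE.
- apply: subspace_eq_continuous (continuous_subspaceT cUt) => z.
  by rewrite inE => -[z1 z2]; rewrite /from_subspace/= utE.
- by move=> t t0; apply/cvg_ex; exists (Ux 0 t); exact: flux.
- by move=> x t x0 t0; rewrite utE// uxxE// fluxE// eqn.
- by move=> x x0; rewrite uU ?(ltW x0)// init.
- by move=> t t0; rewrite uU ?(ltW t0)// bnd.
Unshelve. all: by end_near. Qed.

(** * Calculus of finite sums of products of a function of x and a function of t *)

Lemma is_derive1_exprn (R : realType) (n : nat) (f : R -> R) (x df : R) :
  is_derive x 1 f df ->
  is_derive x 1 (fun y => f y ^+ n) (n%:R * f x ^+ n.-1 * df).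
Proof.
move=> dfx; rewrite (_ : (fun y => f y ^+ n) = f ^+ n); last first.
  by apply/funext => y; rewrite exprfctE.
exact: is_deriveX.
Qed.

Lemma is_derive1_sum_nat (R : realType) (n : nat) (f : nat -> R -> R)
    (df : nat -> R) (x : R) : (forall k, is_derive x 1 (f k) (df k)) ->
  is_derive x 1 (fun y => \sum_(0 <= k < n) f k y) (\sum_(0 <= k < n) df k).
Proof.
move=> dfk; elim: n => [|n IHn].
  rewrite big_geq//; under eq_fun do rewrite big_geq//.
  exact: is_derive_cst.
by rewrite big_nat_recr//=; under eq_fun do rewrite big_nat_recr//=; exact: is_deriveD.
Qed.

Lemma continuous_sum_nat (R : realType) (T : topologicalType) (n : nat)
    (f : nat -> T -> R) : (forall k, continuous (f k)) ->
  continuous (fun z => \sum_(0 <= k < n) f k z).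
Proof.
move=> cf; elim: n => [|n IHn].
  under eq_fun do rewrite big_geq//.
  by move=> z; exact: cvg_cst.
under eq_fun do rewrite big_nat_recr//=.
by move=> z; apply: cvgD; [exact: IHn|exact: cf].
Qed.

(** Common shape of [u0] and its derivatives: differentiation in x replaces only the factors [r],
    differentiation in t only the factors [q]. *)
Definition separable_sum {R : realType} (n : nat) (b : nat -> R)
    (r q : nat -> R -> R) (x t : R) : R :=
  \sum_(0 <= k < n) b k * q k t * r k x.

Lemma is_derive1_separable_sum_x (R : realType) (n : nat) (b : nat -> R)
    (r q : nat -> R -> R) (dr : nat -> R -> R) (x t : R) :
  (forall k, is_derive x 1 (r k) (dr k x)) ->
  is_derive x 1 (fun y => separable_sum n b r q y t) (separable_sum n b dr q x t).
Proof.
by move=> drk; apply: is_derive1_sum_nat.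
Qed.

Lemma is_derive1_separable_sum_t (R : realType) (n : nat) (b : nat -> R)
    (r q : nat -> R -> R) (dq : nat -> R -> R) (x t : R) :
  (forall k, is_derive t 1 (q k) (dq k t)) ->
  is_derive t 1 (fun s => separable_sum n b r q x s) (separable_sum n b r dq x t).
Proof.
move=> dqk; apply: is_derive1_sum_nat => k.
have := dqk k => ?.
apply: is_derive_eq; rewrite /GRing.scale/=. ring.
Qed.

Lemma continuous_separable_sum (R : realType) (n : nat) (b : nat -> R)
    (r q : nat -> R -> R) :
  (forall k, continuous (r k)) -> (forall k, continuous (q k)) ->
  continuous (fun z : R * R => separable_sum n b r q z.1 z.2).
Proof.
move=> cr cq; apply: continuous_sum_nat => k z.
apply: cvgM; first apply: cvgM; first exact: cvg_cst.
  by apply: (@cvg_comp _ _ _ snd (q k) _ (nbhs z.2)); [exact: cvg_snd|exact: cq].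
by apply: (@cvg_comp _ _ _ fst (r k) _ (nbhs z.1)); [exact: cvg_fst|exact: cr].
Qed.

(** * Remainders of the exponential series *)

Definition exp_tail {R : realType} (a : R) (n : nat) (t : R) : R :=
  expR (a * t) - \sum_(0 <= k < n) (a * t) ^+ k / (k`!)%:R.

Lemma exp_tailS (R : realType) (a : R) (n : nat) (t : R) :
  exp_tail a n.+1 t = exp_tail a n t - (a * t) ^+ n / (n`!)%:R.
Proof. by rewrite /exp_tail big_nat_recr//= opprD addrA. Qed.

(** The term of index 0 cancels exp(0) and the others vanish. At least one term must be removed:
    [exp_tail a 0 0] is 1. *)
Lemma exp_tailS0 (R : realType) (a : R) (n : nat) : exp_tail a n.+1 0 = 0.
Proof.
elim: n => [|n IHn]; rewrite exp_tailS.
  by rewrite /exp_tail big_geq// mulr0 expR0 expr0 fact0 divr1 subr0 subrr.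
by rewrite IHn mulr0 expr0n/= mul0r subrr.
Qed.

(** Termwise differentiation shifts the series by one index. The term gained by the shift later
    supplies the power t^p in the equation for W'. *)
Lemma is_derive1_exp_tail (R : realType) (a : R) (n : nat) (t : R) :
  is_derive t 1 (exp_tail a n.+1) (a * exp_tail a n t).
Proof.
elim: n => [|n IHn].
  have -> : exp_tail a 1 = fun s => expR (a * s) - 1.
    by apply/funext => s; rewrite /exp_tail big_nat1 expr0 fact0 divr1.
  rewrite /exp_tail big_geq//.
  by apply: is_derive_eq; rewrite /GRing.scale/=; ring.
have -> : exp_tail a n.+2 = fun s => exp_tail a n.+1 s - (a * s) ^+ n.+1 / (n.+1`!)%:R.
  by apply/funext => s; exact: exp_tailS.
have fn0 : (n`!)%:R != 0 :> R by rewrite pnatr_eq0 -lt0n fact_gt0.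
have dat : is_derive t 1 (fun s => a * s) a.
  by apply: is_derive_eq; rewrite /GRing.scale/= mulr1.
have dX : is_derive t 1 (fun s => (a * s) ^+ n.+1) (n.+1%:R * (a * t) ^+ n * a).
  exact: is_derive1_exprn.
rewrite exp_tailS; apply: is_derive_eq.
rewrite factS natrM /GRing.scale/= mulrS/= exprS.
by field; rewrite fn0/= -mulrS pnatr_eq0.
Qed.

(** * The heat polynomial [u0]: derivatives, heat equation, boundary and initial values *)

Definition u0_coef {R : realType} (eta : R) (m k : nat) : R :=
  eta / Num.sqrt pi * ('C(m, 2 * k)%:R * Gamma ((2 * k + 1)%:R / 2)).

(** Here and in the next two definitions, wherever a predecessor in an exponent is truncated at 0,
    the numerical factor in front is 0 as well. *)
Definition u0_x {R : realType} (eta : R) (p m : nat) : R -> R -> R :=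
  separable_sum p.+1 (u0_coef eta m)
    (fun k x => (m - 2 * k)%:R * x ^+ (m - 2 * k).-1) (fun k t => (4 * t) ^+ k).

Definition u0_xx {R : realType} (eta : R) (p m : nat) : R -> R -> R :=
  separable_sum p.+1 (u0_coef eta m)
    (fun k x => (m - 2 * k)%:R * ((m - 2 * k).-1%:R * x ^+ (m - 2 * k).-2))
    (fun k t => (4 * t) ^+ k).

Definition u0_t {R : realType} (eta : R) (p m : nat) : R -> R -> R :=
  separable_sum p.+1 (u0_coef eta m)
    (fun k x => x ^+ (m - 2 * k)) (fun k t => k%:R * (4 * t) ^+ k.-1 * 4).

Lemma u0E (R : realType) (eta : R) (p m : nat) (x t : R) :
  u0 eta p m x t = separable_sum p.+1 (u0_coef eta m)
    (fun k x => x ^+ (m - 2 * k)) (fun k t => (4 * t) ^+ k) x t.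
Proof.
rewrite /u0 mulr_sumr; apply: eq_bigr => k _.
by rewrite /u0_coef !mulrA.
Qed.

Lemma is_derive1_monomial (R : realType) (n : nat) (x : R) :
  is_derive x 1 (fun y => y ^+ n) (n%:R * x ^+ n.-1).
Proof. by have := is_derive1_exprn _ n _ _ _ (is_derive_id x 1); rewrite mulr1. Qed.

Lemma is_derive1_u0_x (R : realType) (eta : R) (p m : nat) (x t : R) :
  is_derive x 1 (fun y => u0 eta p m y t) (u0_x eta p m x t).
Proof.
under eq_fun do rewrite u0E.
by apply: is_derive1_separable_sum_x => k; exact: is_derive1_monomial.
Qed.

Lemma is_derive1_u0_xx (R : realType) (eta : R) (p m : nat) (x t : R) :
  is_derive x 1 (fun y => u0_x eta p m y t) (u0_xx eta p m x t).
Proof.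
apply: (is_derive1_separable_sum_x _ _ _ _ _ _ _ _ _) => k.
have ? := is_derive1_monomial _ (m - 2 * k).-1 x.
by apply: is_derive_eq; rewrite /GRing.scale/=; ring.
Qed.

Lemma is_derive1_u0_t (R : realType) (eta : R) (p m : nat) (x t : R) :
  is_derive t 1 (fun s => u0 eta p m x s) (u0_t eta p m x t).
Proof.
under eq_fun do rewrite u0E.
apply: is_derive1_separable_sum_t => k; apply: is_derive1_exprn.
by apply: is_derive_eq; rewrite /GRing.scale/= mulr1.
Qed.

Lemma continuous_4exprn (R : realType) (k : nat) :
  continuous (fun t : R => (4 * t) ^+ k).
Proof.
move=> t; apply: is_derive1_continuous.
by apply: is_derive1_exprn; apply: is_derive_eq.
Qed.

(** The term k = 0 of the time derivative vanishes, and so does the term k = p of the second space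
    derivative, where x has exponent 1. Term k+1 of the former then matches term k of the latter, by
    the recurrences of Gamma and of the binomials. *)
Lemma u0_heat (R : realType) (eta : R) (p : nat) (x t : R) :
  u0_t eta p (2 * p + 1) x t = u0_xx eta p (2 * p + 1) x t.
Proof.
rewrite /u0_t /u0_xx /separable_sum big_nat_recl// big_nat_recr//=.
rewrite addnC addnK !mul0r !mulr0 !mul0r add0r addr0.
apply: eq_big_nat => k /andP[_ kp].
set m := (1 + 2 * p)%N.
have -> : (m - 2 * k.+1)%N = (m - 2 * k).-2 by rewrite /m; lia.
(* Two uses of (j+1) C(m, j+1) = (m-j) C(m, j), at j = 2k and j = 2k+1. *)
have binE : ((2 * k + 2) * (2 * k + 1) * 'C(m, 2 * k.+1)
    = (m - 2 * k) * (m - 2 * k).-1 * 'C(m, 2 * k))%N.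
  have b1 := mul_bin_left m (2 * k); have b2 := mul_bin_left m (2 * k).+1.
  rewrite mulnS add2n; rewrite subnS in b2; nia.
rewrite /u0_coef Gamma_halfS.
have binER : k.+1%:R * 4 * ((2 * k + 1)%:R / 2) * 'C(m, 2 * k.+1)%:R
    = (m - 2 * k)%:R * (m - 2 * k).-1%:R * 'C(m, 2 * k)%:R :> R.
  rewrite -!natrM -binE 2!natrM; congr (_ * _).
  by rewrite (_ : 2 * k + 2 = 2 * k.+1)%N ?natrM; [field|lia].
move: (Gamma _) => G.
transitivity (eta / Num.sqrt pi * G * (4 * t) ^+ k * x ^+ (m - 2 * k).-2
  * (k.+1%:R * 4 * ((2 * k + 1)%:R / 2) * 'C(m, 2 * k.+1)%:R)).
  move: 'C(_, _)%:R (_%:R / 2) (x ^+ _) k.+1%:R => a b c d; ring.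
rewrite binER.
move: 'C(_, _)%:R _%:R _%:R (x ^+ _) => a b c d; ring.
Qed.

(** At x = 0 only the term k = p survives, the one linear in x. Its coefficient is c t^p because
    C(2p+1, 2p) = m and 4^p = 2^(m-1). *)
Lemma u0_x_boundary (R : realType) (eta : R) (p : nat) (t : R) :
  u0_x eta p (2 * p + 1) 0 t = coef_c eta (2 * p + 1) * t ^+ p.
Proof.
rewrite /u0_x /separable_sum big_nat_recr//= big_nat big1 => [|k /andP[_ kp]].
  rewrite add0r addnC addnK expr0 mulr1 /u0_coef /coef_c.
  rewrite binSn add1n addn1/= exprM exprMn.
  rewrite (_ : 2 ^+ 2 = 4 :> R); last by ring.
  by ring.
by rewrite expr0n (_ : _ == 0%N = false) ?mulr0//; lia.
Qed.

Lemma u0_initial (R : realType) (eta : R) (p m : nat) (x : R) :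
  u0 eta p m x 0 = eta * x ^+ m.
Proof.
rewrite /u0 big_nat_recl// big1 => [|k _].
  rewrite muln0 add0n bin0 subn0 Gamma_half expr0 addr0 mul1r mulr1.
  by rewrite mulrA divfK// gt_eqF// sqrtr_gt0 pi_gt0.
by rewrite mulr0 exprS mul0r mulr0 mul0r.
Qed.

Lemma u0_boundary (R : realType) (eta : R) (p : nat) (t : R) :
  u0 eta p (2 * p + 1) 0 t = 0.
Proof.
rewrite /u0 big_nat big1 ?mulr0// => k /andP[_ kp].
by rewrite expr0n (_ : _ == 0%N = false) ?mulr0//; lia.
Qed.

Lemma continuous_monomial (R : realType) (a : R) (n : nat) :
  continuous (fun x : R => a * x ^+ n).
Proof. by move=> x; apply: cvgM; [exact: cvg_cst|exact: exprn_continuous]. Qed.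

Lemma continuous_u0 (R : realType) (eta : R) (p m : nat) :
  continuous (fun z : R * R => u0 eta p m z.1 z.2).
Proof.
under eq_fun do rewrite u0E.
apply: continuous_separable_sum => k; last exact: continuous_4exprn.
exact: exprn_continuous.
Qed.

Lemma continuous_u0_x (R : realType) (eta : R) (p m : nat) :
  continuous (fun z : R * R => u0_x eta p m z.1 z.2).
Proof.
apply: continuous_separable_sum => k; last exact: continuous_4exprn.
exact: continuous_monomial.
Qed.

Lemma continuous_u0_xx (R : realType) (eta : R) (p m : nat) :
  continuous (fun z : R * R => u0_xx eta p m z.1 z.2).
Proof.
apply: continuous_separable_sum => k; last exact: continuous_4exprn.
by move=> x; apply: cvgM; [exact: cvg_cst|exact: continuous_monomial].
Qed.

Lemma continuous_u0_t (R : realType) (eta : R) (p m : nat) :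
  continuous (fun z : R * R => u0_t eta p m z.1 z.2).
Proof.
apply: continuous_separable_sum => k; first exact: exprn_continuous.
move=> t; apply: cvgM; last exact: cvg_cst.
by apply: cvgM; [exact: cvg_cst|exact: continuous_4exprn].
Qed.

(** Covers the closed form of u and its derivatives at once: each is a heat polynomial part plus a
    product r(x) q(t). *)
Lemma continuous_add_separable (R : realType) (f : R -> R -> R) (r q : R -> R) :
  continuous (fun z : R * R => f z.1 z.2) -> continuous r -> continuous q ->
  continuous (fun z : R * R => f z.1 z.2 + r z.1 * q z.2).
Proof.
move=> cf cr cq z; apply: cvgD; first exact: cf.
apply: cvgM.
  by apply: (@cvg_comp _ _ _ fst r _ (nbhs z.1)); [exact: cvg_fst|exact: cr].
by apply: (@cvg_comp _ _ _ snd q _ (nbhs z.2)); [exact: cvg_snd|exact: cq].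
Qed.

(** * The closed form of V and the memory integral *)

Lemma coef_c2_exprn (R : realType) (nu lambda mu eta sigma : R) (p m : nat) (t : R) :
  lambda != 0 -> sigma != 0 ->
  coef_c2 nu lambda mu eta sigma p m * ((lambda * sigma * t) ^+ p / (p`!)%:R)
  = coef_c eta m * (nu * mu / sigma) * t ^+ p.
Proof.
move=> lambdan0 sigman0; rewrite /coef_c2 (exprMn p (lambda * sigma)); field.
by rewrite pnatr_eq0 -lt0n fact_gt0 sigman0 expf_neq0// mulf_neq0.
Qed.

(** The term of index p of the truncated series contributes -c (nu mu / sigma) t^p; since sigma =
    lambda + nu mu, adding c t^p leaves (c lambda / sigma) t^p. What remains is the formula for m >=
    7, and the three small cases agree with it. *)
Lemma p2_closed_form (R : realType) (nu lambda mu eta sigma : R) (p : nat) (t : R) :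
  0 < nu -> 0 < lambda -> 0 < mu -> sigma = lambda + nu * mu ->
  p2 nu lambda mu eta sigma p (2 * p + 1) t
    + coef_c2 nu lambda mu eta sigma p (2 * p + 1) * expR (lambda * sigma * t)
  = coef_c eta (2 * p + 1) * t ^+ p
    + coef_c2 nu lambda mu eta sigma p (2 * p + 1)
      * exp_tail (lambda * sigma) p.+1 t.
Proof.
move=> nu0 lambda0 mu0 sigmaE.
have nun0 : nu != 0 by rewrite gt_eqF.
have mun0 : mu != 0 by rewrite gt_eqF.
have lambdan0 : lambda != 0 by rewrite gt_eqF.
have sigman0 : sigma != 0 by rewrite sigmaE gt_eqF// addr_gt0// mulr_gt0.
set c := coef_c eta _; set c2 := coef_c2 _ _ _ _ _ _ _.
have c2E : c2 * ((lambda * sigma * t) ^+ p / (p`!)%:R)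
    = c * t ^+ p - c * lambda / sigma * t ^+ p.
  by rewrite coef_c2_exprn// -/c sigmaE; field; rewrite -sigmaE.
have -> : c * t ^+ p + c2 * exp_tail (lambda * sigma) p.+1 t
    = c * lambda / sigma * t ^+ p
      - c2 * \sum_(0 <= k < p) (lambda * sigma * t) ^+ k / (k`!)%:R
      + c2 * expR (lambda * sigma * t).
  by rewrite exp_tailS /exp_tail !mulrBr c2E; ring.
congr (_ + _); rewrite /p2 -/c -/c2 /c2 /c /coef_c2.
case: p {c2 c2E} @c => [|[|[|p]]] c.
(* For m = 1, Gamma(1/2) = sqrt pi reduces c to eta. *)
- rewrite /= big_geq// /c /coef_c Gamma_half mulr0 subr0 !expr0 mulr1.
  by field; rewrite sigman0 gt_eqF// sqrtr_gt0 pi_gt0.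
- rewrite /= big_nat1 -/c fact0 !expr0 !expr1 (_ : 1`! = 1)%N// divr1.
  by field; rewrite nun0 mun0 lambdan0 sigman0.
- rewrite /= big_nat_recr//= big_nat1 -/c fact0 !expr0 !expr1.
  rewrite (_ : 1`! = 1)%N// (_ : 2`! = 2)%N// !divr1.
  by field; rewrite nun0 mun0 lambdan0 sigman0.
- rewrite !ifF; [|lia|lia].
  (* The term of index 0 becomes the separate summand 1 of [p2]. *)
  rewrite [in RHS]big_ltn// expr0 fact0 divr1.
  under [in RHS]eq_bigr do rewrite exprMn mulrAC.
  by rewrite (addrC 1).
Qed.

(** V is prescribed only for t > 0, so the integrand may take any value at 0. That point is null: it
    is dropped, [g] is replaced by the continuous [f], and the point is put back before the
    fundamental theorem is applied. *)
Lemma Rintegral_FTC2_oc (R : realType) (f g F : R -> R) (t : R) : 0 <= t ->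
  (forall x, 0 < x -> g x = f x) -> continuous f ->
  (forall x : R, is_derive x 1 F (f x)) ->
  \int[lebesgue_measure]_(x in `[0, t]) g x = F t - F 0.
Proof.
rewrite le_eqVlt => /predU1P[<-|t0] gf cf dF.
  by rewrite set_itv1 Rintegral_set1 subrr.
have mf : measurable_fun `]0, t] f.
  apply: subspace_continuous_measurable_fun; first exact: measurable_itv.
  exact: continuous_subspaceT.
have gfE : {in `]0, t]%classic, g =1 f}.
  by move=> x; rewrite inE/= in_itv/= => /andP[x0 _]; exact: gf.
have mg : measurable_fun `]0, t] g.
  by apply: eq_measurable_fun mf => x /gfE.
have cF x : {for x, continuous F} by exact: is_derive1_continuous.
rewrite /Rintegral -integral_itv_obnd_cbnd; last exact/measurable_EFinP.
under eq_integral => x xt do rewrite gfE//.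
rewrite integral_itv_obnd_cbnd; last exact/measurable_EFinP.
rewrite (continuous_FTC2 (F := F) t0)//.
- exact: continuous_subspaceT.
- split.
  + by move=> x _; case: (dF x).
  + exact/cvg_at_right_filter/cF.
  + exact/cvg_at_left_filter/cF.
- by move=> x _; rewrite derive1E; case: (dF x).
Qed.

(** * The explicit solution of Problem P *)

Theorem proposition2p6 (R : realType) (nu lambda mu eta sigma : R) (m p : nat)
  (F : R -> R -> R) (h Phi V : R -> R) (u : R -> R -> R)
  (nu_gt0 : 0 < nu) (lambda_gt0 : 0 < lambda) (mu_gt0 : 0 < mu)
  (eta_neq0 : eta <> 0)
  (sigmaE : sigma = lambda + nu * mu) (sigma_neq0 : sigma <> 0)
  (mE : m = (2 * p + 1)%N)
  (FE : forall v t : R, 0 < t -> F v t = nu * v)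
  (hE : forall x : R, 0 < x -> h x = eta * x ^+ m)
  (PhiE : forall x : R, 0 <= x -> Phi x = - mu * sinh (lambda * x))
  (VE : forall t : R, 0 < t ->
    V t = p2 nu lambda mu eta sigma p m t
          + coef_c2 nu lambda mu eta sigma p m * expR (lambda * sigma * t))
  (uE : forall x t : R, 0 <= x -> 0 <= t ->
    u x t = u0 eta p m x t
            - nu * Phi x * expR (lambda ^+ 2 * t)
              * (\int[lebesgue_measure]_(tau in `[0, t])
                   (V tau * expR (- lambda ^+ 2 * tau)))) :
  solves_problem_P Phi F h u /\
  (forall t : R, 0 < t -> pderiv_x0 u t = V t).

Proof.
have lambdan0 : lambda != 0 by rewrite gt_eqF.
have nun0 : nu != 0 by rewrite gt_eqF.
have mun0 : mu != 0 by rewrite gt_eqF.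
have sigman0 : sigma != 0 by exact/eqP.
subst m; set m := (2 * p + 1)%N in VE uE *.
pose c := coef_c eta m; pose c2 := coef_c2 nu lambda mu eta sigma p m.
pose W t := c2 * exp_tail (lambda * sigma) p.+1 t.
pose v t := c * t ^+ p + W t.
have Vv t : 0 < t -> V t = v t by move=> t0; rewrite VE// p2_closed_form.
have W0 : W 0 = 0 by rewrite /W exp_tailS0 mulr0.
have dW (t : R) : is_derive t 1 W (lambda ^+ 2 * W t + lambda * nu * mu * v t).
  have ? := is_derive1_exp_tail _ (lambda * sigma) p t.
  apply: is_derive_eq.
  (* Restoring the term of index p gives W' = lambda sigma W + lambda nu mu c t^p; then lambda sigma
     = lambda^2 + lambda nu mu yields the stated form. *)
  have := exp_tailS _ (lambda * sigma) p t => /eqP; rewrite eq_sym subr_eq => /eqP ->.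
  rewrite /GRing.scale/= mulrCA mulrDr /c2 coef_c2_exprn// -/c -/c2 -/(W t) /v sigmaE.
  by field; rewrite -sigmaE.
have cW : continuous W by move=> t; exact: is_derive1_continuous (dW t).
have cv : continuous v.
  move=> t; apply: cvgD (cW t); apply: cvgM; first exact: cvg_cst.
  exact: exprn_continuous.
pose e (t : R) := expR (- lambda ^+ 2 * t).
have de (t : R) : is_derive t 1 e (- lambda ^+ 2 * e t).
  by apply: is_derive_eq; rewrite /GRing.scale/= /e; ring.
have intE t : 0 <= t ->
    \int[lebesgue_measure]_(tau in `[0, t]) (V tau * expR (- lambda ^+ 2 * tau))
    = e t * W t / (lambda * nu * mu).
  move=> t0.
  (* [e] is an integrating factor: in (e W)' the lambda^2 terms cancel and lambda nu mu v e is
     left. *)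
  have dF (s : R) :
      is_derive s 1 (fun s => (lambda * nu * mu)^-1 * (e s * W s)) (v s * e s).
    apply: is_derive_eq; rewrite /GRing.scale/=.
    by field; rewrite lambdan0 nun0 mun0.
  have cve : continuous (fun s => v s * e s).
    by move=> s; apply: cvgM; [exact: cv|exact: is_derive1_continuous (de s)].
  rewrite (Rintegral_FTC2_oc _ _ _ _ _ t0 _ cve dF); last by move=> s s0; rewrite Vv.
  by rewrite W0 !mulr0 subr0 mulrC.
(* [S] is normalised to have slope 1 at 0, so that [S x * W t] contributes exactly [W t] to the
   flux; its derivative [C] is cosh(lambda x). *)
pose S (x : R) := sinh (lambda * x) / lambda.
pose C (x : R) := (expR (lambda * x) + expR (- (lambda * x))) / 2.
have dS (x : R) : is_derive x 1 S (C x).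
  by rewrite /S /sinh; apply: is_derive_eq; rewrite /GRing.scale/= /C; field.
have dC (x : R) : is_derive x 1 C (lambda ^+ 2 * S x).
  rewrite /C; apply: is_derive_eq; rewrite /GRing.scale/= /S /sinh; field.
  by [].
have dU (x t : R) : is_derive x 1 (fun y => u0 eta p m y t + S y * W t)
    (u0_x eta p m x t + C x * W t).
  have ? := is_derive1_u0_x _ eta p m x t.
  by apply: is_derive_eq; rewrite /GRing.scale/=; ring.
have dUx (x t : R) : is_derive x 1 (fun y => u0_x eta p m y t + C y * W t)
    (u0_xx eta p m x t + lambda ^+ 2 * S x * W t).
  have ? := is_derive1_u0_xx _ eta p m x t.
  by apply: is_derive_eq; rewrite /GRing.scale/=; ring.
have dUt (x t : R) : is_derive t 1 (fun s => u0 eta p m x s + S x * W s)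
    (u0_t eta p m x t + S x * (lambda ^+ 2 * W t + lambda * nu * mu * v t)).
  have ? := is_derive1_u0_t _ eta p m x t.
  by apply: is_derive_eq; rewrite /GRing.scale/=; ring.
have cS : continuous S by move=> x; exact: is_derive1_continuous (dS x).
have cC : continuous C by move=> x; exact: is_derive1_continuous (dC x).
have cSxx : continuous (fun x => lambda ^+ 2 * S x).
  by move=> x; apply: cvgM; [exact: cvg_cst|exact: cS].
have cWt : continuous (fun t => lambda ^+ 2 * W t + lambda * nu * mu * v t).
  move=> t; apply: cvgD.
    by apply: cvgM; [exact: cvg_cst|exact: cW].
  by apply: cvgM; [exact: cvg_cst|exact: cv].
have flux0 t : u0_x eta p m 0 t + C 0 * W t = v t.
  by rewrite u0_x_boundary /C mulr0 oppr0 expR0 /v -/c; field.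
have [||||||||sol fluxE] := solves_problem_P_closed_form R Phi F h u
  (fun x t => u0 eta p m x t + S x * W t) _ _ _ _ dU dUx dUt.
(* The factors exp(lambda^2 t) and [e t] cancel, and nu mu sinh(lambda x) / (lambda nu mu) is
   [S x]. *)
- move=> x t x0 t0; rewrite uE// PhiE// intE//.
  rewrite (_ : e t = (expR (lambda ^+ 2 * t))^-1); last by rewrite /e mulNr expRN.
  by rewrite /S; field; rewrite lambdan0 nun0 mun0 gt_eqF// expR_gt0.
- exact: continuous_add_separable (continuous_u0 _ _ _ _) cS cW.
- exact: continuous_add_separable (continuous_u0_x _ _ _ _) cC cW.
- exact: continuous_add_separable (continuous_u0_xx _ _ _ _) cSxx cW.
- exact: continuous_add_separable (continuous_u0_t _ _ _ _) cS cWt.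
(* The heat polynomial and the terms lambda^2 S W cancel; what is left, lambda nu mu S v, equals
   -Phi nu v. *)
- move=> x t x0 t0; rewrite u0_heat flux0 FE// PhiE ?(ltW x0)// /S.
  by field.
- by move=> x x0; rewrite u0_initial W0 mulr0 addr0 hE.
- by move=> t t0; rewrite u0_boundary /S mulr0 /sinh oppr0 subrr !mul0r addr0.
by split => // t t0; rewrite fluxE// flux0 Vv.
Qed.
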